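(* Let $n,m\ge1$ be integers and let $1<p<q<\infty$, with dual exponents $p',q'$. Suppose $m<p'/q'$, $1<s_k<p'/q'$ for $k=1,\dots,m$, and $\frac1q+\frac m{p'}=\sum_{k=1}^m\frac1{s_k}$. There is a constant $C\le1$, depending only on $n,m,p,q,s_1,\dots,s_m$, such that for all $g_k\in L^{s_k}(\mathbb R^n)$ and all $H\in L^p(\mathbb R^{nm})$, the function $$F(x)=\int_{\mathbb R^{nm}}\prod_{k=1}^m g_k(x-y_k)\,H(y_1,\dots,y_m)\,dy_1\cdots dy_m,\qquad x\in\mathbb R^n,$$ satisfies $$\|F\|_{L^q(\mathbb R^n)}\le C\prod_{k=1}^m\|g_k\|_{L^{s_k}(\mathbb R^n)}\,\|H\|_{L^p(\mathbb R^{nm})}.$$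
   Context: Points of $\mathbb R^{nm}$ are written $(y_1,\dots,y_m)$ with $y_k\in\mathbb R^n$. Primes denote dual exponents: $1/p+1/p'=1$, $1/q+1/q'=1$. *)

(* Defs.v *)
From HB Require Import structures.
From mathcomp Require Import all_boot all_order all_algebra.
From mathcomp Require Import all_classical all_reals all_analysis.
From mathcomp Require Import complex.

Set Implicit Arguments.
Unset Strict Implicit.
Unset Printing Implicit Defensive.

Import Order.TTheory GRing.Theory Num.Theory.
Import numFieldNormedType.Exports.

Local Open Scope classical_set_scope.
Local Open Scope ring_scope.

Definition tuple_cons (T : Type) (n : nat) (xt : T * n.-tuple T) :
  n.+1.-tuple T := [tuple of xt.1 :: xt.2].

Lemma measurable_tuple_cons d (T : measurableType d) n :
  measurable_fun [set: T * n.-tuple T] (@tuple_cons T n).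
Proof. exact: measurable_cons. Qed.

Section cons_measure.
Context {d} {T : measurableType d} {R : realType} {n : nat}.
Context (mu : {sigma_finite_measure set T -> \bar R}).
Context (nu : {sigma_finite_measure set (n.-tuple T) -> \bar R}).
Local Open Scope ereal_scope.

Definition cons_measure : set (n.+1.-tuple T) -> \bar R :=
  pushforward (mu \x nu) (@tuple_cons T n).

Let P : {measure set (n.+1.-tuple T) -> \bar R} :=
  measure_function_pushforward__canonical__measure_function_Measure
    (mu \x nu) (@measurable_tuple_cons d T n).

Let cons_measure0 : cons_measure set0 = 0.
Proof. exact: (measure0 P). Qed.

Let cons_measure_ge0 A : 0 <= cons_measure A.
Proof. exact: (measure_ge0 P). Qed.

Let cons_measure_semi_sigma_additive : semi_sigma_additive cons_measure.
Proof. exact: (@measure_semi_sigma_additive _ _ _ P). Qed.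

HB.instance Definition _ := isMeasure.Build _ _ _ cons_measure
  cons_measure0 cons_measure_ge0 cons_measure_semi_sigma_additive.

Let cons_measure_sigma_finite : sigma_finite setT cons_measure.
Proof.
have /sigma_finiteP[F [FT ndF Foo]] := sigma_finiteT mu.
have /sigma_finiteP[G [GT ndG Goo]] := sigma_finiteT nu.
pose u (t : n.+1.-tuple T) : T * n.-tuple T := (thead t, [tuple of behead t]).
have um : measurable_fun setT u.
  apply/measurable_fun_pair => /=; first exact: measurable_tnth.
  exact: measurable_behead.
have cu : cancel (@tuple_cons T n) u.
  by move=> [x t]; congr pair; apply: val_inj.
exists (fun k => u @^-1` (F k `*` G k)).
  rewrite -preimage_bigcup; apply/esym/seteqP; split=> // t _.
  have [i _ Fi] : (\bigcup_i F i) (u t).1 by rewrite -FT.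
  have [j _ Gj] : (\bigcup_i G i) (u t).2 by rewrite -GT.
  exists (maxn i j) => //; split.
    by move: Fi; exact/subsetPset/ndF/leq_maxl.
  by move: Gj; exact/subsetPset/ndG/leq_maxr.
move=> k; have [mF Fk] := Foo k; have [mG Gk] := Goo k; split.
  by rewrite -[X in measurable X]setTI; apply: um => //; exact: measurableX.
rewrite /cons_measure /pushforward -comp_preimage.
rewrite (_ : u \o _ = id) //; last by apply/funext => x; exact: cu.
by rewrite preimage_id product_measure1E// lte_mul_pinfty// ge0_fin_numE.
Qed.

HB.instance Definition _ := Measure_isSigmaFinite.Build _ _ _ cons_measure
  cons_measure_sigma_finite.

End cons_measure.

(* The n-fold product measure on n-tuples; see tuple_measure_box for its
   values on boxes, which determine it. *)
Fixpoint tuple_measure d (T : measurableType d) (R : realType)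
    (mu : {sigma_finite_measure set T -> \bar R}) (n : nat) :
    {sigma_finite_measure set (n.-tuple T) -> \bar R} :=
  match n with
  | 0 => @dirac _ (0.-tuple T) [tuple] R
  | k.+1 => cons_measure mu (tuple_measure mu k)
  end.

Lemma measurable_box d (T : measurableType d) n (A : 'I_n -> set T) :
  (forall i, measurable (A i)) ->
  measurable [set x : n.-tuple T | forall i, A i (tnth x i)].
Proof.
move=> mA.
rewrite (_ : mkset _ = \big[setI/setT]_(i < n) ((fun x => tnth x i) @^-1` A i)).
  apply: bigsetI_measurable => i _.
  by rewrite -[X in measurable X]setTI; apply: measurable_tnth => //; exact: mA.
rewrite -bigcap_seq; apply/seteqP; split => x /= h i.
  by move=> _; exact: h.
by apply: (h i); rewrite /= mem_index_enum.
Qed.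

Lemma tuple_measure_box d (T : measurableType d) (R : realType)
    (mu : {sigma_finite_measure set T -> \bar R}) n (A : 'I_n -> set T) :
  (forall i, measurable (A i)) ->
  (tuple_measure mu n [set x | forall i, A i (tnth x i)]
   = \prod_(i < n) mu (A i))%E.
Proof.
elim: n A => [|n IH] A mA.
  by rewrite big_ord0 /= diracE mem_set // => -[].
rewrite big_ord_recl /= -IH; last by move=> i; exact: mA.
have mB := measurable_box (fun i : 'I_n => mA (lift ord0 i)).
rewrite -[RHS](product_measure1E mu (tuple_measure mu n) (mA ord0) mB).
rewrite /cons_measure /pushforward; congr (_ _).
apply/seteqP; split => -[x t] /=.
  move=> h; split; first exact: (h ord0).
  by move=> i; have := h (lift ord0 i); rewrite tnthS.
move=> [Ax At] i; case: (unliftP ord0 i) => [j|] -> //.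
by rewrite tnthS; exact: At.
Qed.

Definition Rn (R : realType) (n : nat) := n.-tuple (measurableTypeR R).

Definition Rn_sub (R : realType) (n : nat) (x y : Rn R n) : Rn R n :=
  [tuple tnth x i - tnth y i | i < n].

Definition Rn_lebesgue (R : realType) (n : nat) :
    {sigma_finite_measure set (Rn R n) -> \bar R} :=
  tuple_measure (@lebesgue_measure R) n.

(* R^(nm), whose points are (y_1, ..., y_m) with y_k in R^n. *)
Definition Rnm (R : realType) (n m : nat) := m.-tuple (Rn R n).

Definition Rnm_lebesgue (R : realType) (n m : nat) :
    {sigma_finite_measure set (Rnm R n m) -> \bar R} :=
  tuple_measure (Rn_lebesgue R n) m.

(* The library integrates real-valued functions only; measurability,
   integrability and integrals of complex-valued functions are taken on real
   and imaginary parts. *)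
Section complex_valued.
Context {d} {T : measurableType d} {R : realType}.
Context (mu : {measure set T -> \bar R}).
Implicit Type f : T -> R[i].

Definition cmeasurable_fun f : Prop :=
  measurable_fun setT (fun x => complex.Re (f x)) /\
  measurable_fun setT (fun x => complex.Im (f x)).

Definition cintegrable f : Prop :=
  mu.-integrable setT (fun x => (complex.Re (f x))%:E) /\
  mu.-integrable setT (fun x => (complex.Im (f x))%:E).

Definition cintegral f : R[i] :=
  Complex (\int[mu]_x complex.Re (f x)) (\int[mu]_x complex.Im (f x)).

Definition cLnorm (p : R) f : \bar R :=
  ('N[mu]_(p%:E)[EFin \o (@Normc.normc R \o f)])%E.

Definition cLfun (p : R) : set (T -> R[i]) :=
  [set f | cmeasurable_fun f /\ (cLnorm p f < +oo)%E].

End complex_valued.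

Definition multiconv_integrand (R : realType) (n m : nat)
    (g : 'I_m -> Rn R n -> R[i]) (H : Rnm R n m -> R[i]) (x : Rn R n)
    (y : Rnm R n m) : R[i] :=
  (\prod_(k < m) g k (Rn_sub x (tnth y k))) * H y.

(* At a point x where the integrand is not integrable the value is
   meaningless. *)
Definition multiconv (R : realType) (n m : nat)
    (g : 'I_m -> Rn R n -> R[i]) (H : Rnm R n m -> R[i]) (x : Rn R n) : R[i] :=
  cintegral (Rnm_lebesgue R n m) (multiconv_integrand g H x).

(* Main.v *)
(* With G_k = |g_k|^(s_k), K = |H|^p and the positive weights
     u = 1/p',  v = 1/q' - 1/p',  w_k = 1/s_k - 1/p',
   whose sum is 1, the integrand has modulus
     (prod_k G_k(x - y_k))^u * K(y)^v * prod_k (K(y) G_k(x - y_k))^(w_k).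
   Hoelder's inequality in y bounds |F(x)| by
     (prod_k \int G_k)^u * (\int K)^v * prod_k Phi_k(x)^(w_k),
   where Phi_k(x) = \int K(y) G_k(x - y_k) dy.  As q * sum_k w_k = 1, raising to
   the power q and applying Hoelder's inequality in x leaves only
   \int Phi_k = \int K * \int G_k (Tonelli), and one may take C = 1. *)

Require Import Defs.
From HB Require Import structures.
From mathcomp Require Import all_boot all_order all_algebra.
From mathcomp Require Import all_classical all_reals all_analysis.
From mathcomp Require Import measurable_realfun complex ring.

Set Implicit Arguments.
Unset Strict Implicit.
Unset Printing Implicit Defensive.

Import Order.TTheory GRing.Theory Num.Theory.
Import numFieldNormedType.Exports.

Local Open Scope classical_set_scope.
Local Open Scope ring_scope.

(** * Finite products and powers of nonnegative extended reals *)

Section ereal_products.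
Context {R : realType} {I : Type}.
Implicit Types (s : seq I) (P : pred I) (a : I -> \bar R).
Local Open Scope ereal_scope.

Lemma prode_ge0 s P a : (forall i, P i -> 0 <= a i) ->
  0 <= \prod_(i <- s | P i) a i.
Proof. by move=> a0; elim/big_ind : _ => // x y; exact: mule_ge0. Qed.

Lemma prode_gt0 s P a : (forall i, P i -> 0 < a i) ->
  0 < \prod_(i <- s | P i) a i.
Proof.
by move=> a0; elim/big_ind : _ => // x y; exact: mule_gt0.
Qed.

Lemma prode_fin_num s P a : (forall i, P i -> a i \is a fin_num) ->
  \prod_(i <- s | P i) a i \is a fin_num.
Proof. by move=> afin; elim/big_ind : _ => // x y; exact: fin_numM. Qed.

Lemma poweR_prod s P a (r : R) : (forall i, P i -> 0 <= a i) ->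
  (\prod_(i <- s | P i) a i) `^ r = \prod_(i <- s | P i) a i `^ r.
Proof.
move=> a0; elim: s => [|i s ih]; first by rewrite !big_nil poweR1r.
by rewrite !big_cons; case: ifPn => // Pi; rewrite poweRM ?ih ?a0// prode_ge0.
Qed.

End ereal_products.

Lemma emeasurable_prod d (T : measurableType d) (R : realType) (I : Type)
    (s : seq I) (P : pred I) (f : I -> T -> \bar R) :
  (forall i, measurable_fun setT (f i)) ->
  measurable_fun setT (fun x => (\prod_(i <- s | P i) f i x)%E).
Proof.
move=> mf; elim: s => [|i s ih].
  by under eq_fun do rewrite big_nil; exact: measurable_cst.
under eq_fun do rewrite big_cons.
by case: (P i) => //; exact: emeasurable_funM.
Qed.

(** * The weighted inequality between geometric and arithmetic means *)

Lemma weighted_amgm (R : realType) (I : finType) (w a : I -> R) :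
  (forall i, 0 < w i) -> \sum_i w i = 1 -> (forall i, 0 <= a i) ->
  \prod_i a i `^ w i <= \sum_i w i * a i.
Proof.
move=> w0 w1 a0.
have S0 : 0 <= \sum_i w i * a i.
  by apply: sumr_ge0 => i _; rewrite mulr_ge0// ltW.
(* Zero entries are set aside, since [powR] is [expR] of a multiple of [ln] only at a nonzero base;
   a positive weight makes such a factor zero. *)
have [[i /eqP ai]|ane] := pselect (exists i, a i == 0).
  by rewrite (bigD1 i)//= ai powR0 ?mul0r// gt_eqF.
have {}a0 i : 0 < a i.
  by rewrite lt_neqAle a0 andbT eq_sym; apply/negP => ?; apply: ane; exists i.
set S := \sum_i w i * a i in S0 *.
(* With all [a i] positive, [S = 0] would force every weight to vanish, against their sum being
   1. *)
have {}S0 : 0 < S.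
  rewrite lt_neqAle S0 andbT eq_sym; apply/negP => /eqP S_eq0.
  have /eqP := S_eq0; rewrite psumr_eq0 => [/allP wa0|i _]; last first.
    by rewrite mulr_ge0// ltW.
  have : \sum_i w i = 0.
    apply: big1 => i _; have := wa0 i (mem_index_enum _).
    by rewrite mulf_eq0 (gt_eqF (a0 i)) orbF => /eqP.
  by rewrite w1 => /eqP; rewrite oner_eq0.
(* ln (a i / S) <= a i / S - 1, averaged against the weights *)
have lnle i : ln (a i) <= ln S + (a i / S - 1).
  rewrite -lerBlDl -ln_div ?posrE//.
  rewrite lerBrDl; apply: le_trans (expR_ge1Dx _) _.
  by rewrite lnK// posrE divr_gt0.
under eq_bigr do rewrite /powR gt_eqF//.
rewrite -expR_sum -[leRHS]lnK ?posrE// ler_expR.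
apply: (@le_trans _ _ (\sum_i w i * (ln S + (a i / S - 1)))).
  by apply: ler_sum => i _; rewrite ler_wpM2l// ltW.
under eq_bigr do rewrite mulrDr mulrBr mulr1 mulrA.
rewrite big_split/= sumrB -!mulr_suml w1 mul1r -/S mulfV ?gt_eqF//.
by rewrite subrr addr0.
Qed.

Lemma weighted_amgme (R : realType) (I : finType) (w : I -> R)
    (a : I -> \bar R) :
  (forall i, 0 < w i) -> \sum_i w i = 1 -> (forall i, (0 <= a i)%E) ->
  (\prod_i a i `^ w i <= \sum_i (w i)%:E * a i)%E.
Proof.
move=> w0 w1 a0.
(* An infinite entry has positive weight and the other terms are nonnegative, so the right side is
   [+oo]; otherwise everything is real. *)
have [[i ai]|afin] := pselect (exists i, a i = +oo%E).
  rewrite [leRHS](bigD1 i)//= ai gt0_muley ?lte_fin// addye ?leey//.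
  rewrite gt_eqF// (@lt_le_trans _ _ 0%E)//.
  by apply: sume_ge0 => j _; rewrite mule_ge0// lee_fin ltW.
have af i : a i = (fine (a i))%:E.
  rewrite fineK// ge0_fin_numE// ltey; apply/eqP => ai.
  by apply: afin; exists i.
under eq_bigr do rewrite af poweR_EFin.
under [leRHS]eq_bigr do rewrite af -EFinM.
rewrite prodEFin sumEFin lee_fin; apply: weighted_amgm => // i.
exact: fine_ge0.
Qed.

(** * Hölder's inequality for finitely many functions *)

Section hoelder_prod.
Context d (T : measurableType d) (R : realType).
Variable mu : {measure set T -> \bar R}.
Local Open Scope ereal_scope.

(** Divide each function by its integral, apply the weighted mean inequality pointwise and
    integrate: the normalised right side becomes the sum of the weights, which is 1. *)
Lemma hoelder_prod (I : finType) (w : I -> R) (f : I -> T -> \bar R) :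
  (forall i, 0 < w i)%R -> (\sum_i w i = 1)%R ->
  (forall i, measurable_fun setT (f i)) -> (forall i x, 0 <= f i x) ->
  \int[mu]_x \prod_i f i x `^ w i <= \prod_i (\int[mu]_x f i x) `^ w i.
Proof.
move=> w0 w1 mf f0.
have mfw i : measurable_fun setT (fun x => f i x `^ w i).
  exact: (measurableT_comp (@measurable_poweR _ _)).
have mprod := emeasurable_prod (index_enum I) xpredT mfw.
have if0 i : 0 <= \int[mu]_x f i x by exact: integral_ge0.
(* The vanishing case comes first: a zero integral makes its function, hence the product, vanish
   almost everywhere. Afterwards all integrals are positive, so an infinite one makes the right side
   infinite in spite of [0 * +oo = 0]. *)
have [[i fi0]|fne0] := pselect (exists i, \int[mu]_x f i x = 0).
  rewrite [leLHS](_ : _ = 0); first by apply: prode_ge0 => *; exact: poweR_ge0.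
  have : ae_eq mu setT (f i) (cst 0).
    apply/(ae_eq_integral_abs mu measurableT (mf i)).
    by under eq_integral do rewrite gee0_abs//.
  move=> fi_ae; rewrite -(@integral0 _ _ _ mu setT).
  apply: ge0_ae_eq_integral => //.
    by move=> x _; apply: prode_ge0 => *; exact: poweR_ge0.
  apply: filterS fi_ae => x /= fix0 _.
  by rewrite (bigD1 i)//= fix0// poweR0r ?mul0e// gt_eqF.
have {}if0 i : 0 < \int[mu]_x f i x.
  rewrite lt_neqAle if0 andbT eq_sym; apply/negP => /eqP fi0.
  by apply: fne0; exists i.
have [[i fioo]|fney] := pselect (exists i, \int[mu]_x f i x = +oo).
  rewrite (bigD1 i)//= fioo poweRyr ?gt_eqF// gt0_mulye ?leey//.
  by apply: prode_gt0 => j _; exact: poweR_gt0.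
pose c i := fine (\int[mu]_x f i x).
have ifE i : \int[mu]_x f i x = (c i)%:E.
  rewrite fineK// ge0_fin_numE ?ltW// ltey; apply/eqP => fioo.
  by apply: fney; exists i.
have c0 i : (0 < c i)%R by rewrite -lte_fin -ifE.
pose K := \prod_i (c i)%:E `^ w i.
have K0 : 0 <= K by apply: prode_ge0 => *; exact: poweR_ge0.
(* The mean inequality is applied to [f i x / c i], and [K] collects the normalising constants. *)
have amgm x : \prod_i f i x `^ w i <=
    K * \sum_i (w i / c i)%:E * f i x.
  have -> : \prod_i f i x `^ w i = K * \prod_i ((c i)^-1%:E * f i x) `^ w i.
    rewrite -big_split; apply: eq_bigr => i _.
    rewrite -[RHS]poweRM ?lee_fin ?mule_ge0 ?lee_fin ?invr_ge0 ?(ltW (c0 i))//.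
    by rewrite muleA -EFinM mulfV ?mul1e// gt_eqF.
  rewrite lee_wpmul2l//.
  under [leRHS]eq_bigr do rewrite EFinM -muleA.
  apply: weighted_amgme => // i.
  by rewrite mule_ge0// lee_fin invr_ge0 ltW.
have wc0 i : 0 <= (w i / c i)%:E by rewrite lee_fin divr_ge0 ?ltW.
have mwf i : measurable_fun setT (fun x => (w i / c i)%:E * f i x).
  by apply: emeasurable_funM => //; exact: measurable_cst.
have sum0 x : 0 <= \sum_i (w i / c i)%:E * f i x.
  by apply: sume_ge0 => i _; exact: mule_ge0.
apply: (@le_trans _ _ (\int[mu]_x (K * \sum_i (w i / c i)%:E * f i x))).
  apply: ge0_le_integral => //.
  - by move=> x _; apply: prode_ge0 => *; exact: poweR_ge0.
  - apply: emeasurable_funM; first exact: measurable_cst.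
    exact: emeasurable_sum.
rewrite ge0_integralZl//; last exact: emeasurable_sum.
rewrite ge0_integral_sum//; last by move=> i x _; exact: mule_ge0.
rewrite [X in K * X](_ : _ = 1) ?mule1.
  by rewrite /K; under [leRHS]eq_bigr do rewrite ifE.
rewrite -w1 -sumEFin; apply: eq_bigr => i _.
rewrite ge0_integralZl//= ifE -EFinM divfK// gt_eqF//.
Qed.

(** The shape needed for the integral in [y]: one factor for the product of all [G k], one for [K],
    and one for each pairing of [K] with a [G k]. *)
Lemma hoelder_prod2 m (u v : R) (w : 'I_m -> R) (a b : T -> \bar R)
    (f : 'I_m -> T -> \bar R) :
  (0 < u)%R -> (0 < v)%R -> (forall i, 0 < w i)%R ->
  (u + v + \sum_i w i = 1)%R ->
  measurable_fun setT a -> measurable_fun setT b ->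
  (forall i, measurable_fun setT (f i)) ->
  (forall x, 0 <= a x) -> (forall x, 0 <= b x) -> (forall i x, 0 <= f i x) ->
  \int[mu]_x (a x `^ u * b x `^ v * \prod_i f i x `^ w i) <=
  (\int[mu]_x a x) `^ u * (\int[mu]_x b x) `^ v *
  \prod_i (\int[mu]_x f i x) `^ w i.
Proof.
move=> u0 v0 w0 uvw1 ma mb mf a0 b0 f0.
(* Weights and functions are indexed together by ['I_m.+2]. Being polymorphic in [S], [cons2] serves
   both, and [consP] transfers any hypothesis to the enlarged family. *)
pose cons2 (S : Type) (s t : S) (r : 'I_m -> S) (i : 'I_m.+2) : S :=
  oapp (fun j => oapp r t (unlift ord0 j)) s (unlift ord0 i).
have consP S (P : S -> Prop) s t r i :
    P s -> P t -> (forall j, P (r j)) -> P (cons2 S s t r i).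
  by rewrite /cons2; case: (unlift _ i) => //= j; case: (unlift _ j) => /=.
have c0 S s t r : cons2 S s t r ord0 = s by rewrite /cons2 unlift_none.
have c1 S s t r : cons2 S s t r (lift ord0 ord0) = t.
  by rewrite /cons2 liftK/= unlift_none.
have cS S s t r j : cons2 S s t r (lift ord0 (lift ord0 j)) = r j.
  by rewrite /cons2 liftK/= liftK.
rewrite [leLHS](_ : _ = \int[mu]_x
    \prod_(i < m.+2) cons2 _ a b f i x `^ cons2 _ u v w i); last first.
  apply: eq_integral => x _; rewrite !big_ord_recl !c0 !c1 muleA.
  by congr (_ * _); apply: eq_bigr => i _; rewrite !cS.
rewrite [leRHS](_ : _ = \prod_(i < m.+2)
    (\int[mu]_x cons2 _ a b f i x) `^ cons2 _ u v w i); last first.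
  rewrite !big_ord_recl !c0 !c1 muleA.
  by congr (_ * _); apply: eq_bigr => i _; rewrite !cS.
apply: hoelder_prod.
- by move=> i; exact: (consP _ (fun z => 0 < z)%R).
- rewrite !big_ord_recl c0 c1 addrA -[RHS]uvw1; congr (_ + _)%R.
  by apply: eq_bigr => i _; rewrite cS.
- by move=> i; exact: (consP _ (measurable_fun setT)).
- by move=> i; exact: (consP _ (fun g => forall x, 0 <= g x)).
Qed.

End hoelder_prod.

(** * Tonelli's theorem and invariance for product measures on tuples *)

Section tuple_measure_integral.
Context d (T : measurableType d) (R : realType).
Variable mu : {sigma_finite_measure set T -> \bar R}.
Local Open Scope ereal_scope.

(** The measure on [n.+1]-tuples is the image of a binary product under [tuple_cons], so a change of
    variables followed by Tonelli peels off the first coordinate. All inductions on the dimension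
    rest on this. *)
Lemma ge0_integral_tuple_measureS n (f : n.+1.-tuple T -> \bar R) :
  measurable_fun setT f -> (forall t, 0 <= f t) ->
  \int[tuple_measure mu n.+1]_t f t =
  \int[mu]_x \int[tuple_measure mu n]_t f (tuple_cons (x, t)).
Proof.
move=> mf f0; have mc := @measurable_tuple_cons _ T n.
transitivity (\int[mu \x tuple_measure mu n]_z (f \o @tuple_cons T n) z).
  rewrite -[RHS](ge0_integral_pushforward mc (mu \x tuple_measure mu n)%E
    measurableT mf)//.
by rewrite (fubini_tonelli1 _ (measurableT_comp mf mc)) => [|z]; last exact: f0.
Qed.

Lemma measurable_tuple_consr n x :
  measurable_fun setT (fun t : n.-tuple T => tuple_cons (x, t)).
Proof.
apply: (measurableT_comp (@measurable_tuple_cons _ T n)).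
exact: pair1_measurable.
Qed.

(** Maps preserving [mu] coordinate by coordinate preserve the product measure. By induction: the
    inner integral is handled with the first coordinate frozen at [phi ord0 x], the outer one by the
    invariance under [phi ord0]. *)
Lemma ge0_integral_tuple_map n (phi : 'I_n -> T -> T)
    (f : n.-tuple T -> \bar R) :
  (forall i, measurable_fun setT (phi i)) ->
  (forall i (h : T -> \bar R), measurable_fun setT h -> (forall x, 0 <= h x) ->
    \int[mu]_x h (phi i x) = \int[mu]_x h x) ->
  measurable_fun setT f -> (forall t, 0 <= f t) ->
  \int[tuple_measure mu n]_t f [tuple phi i (tnth t i) | i < n] =
  \int[tuple_measure mu n]_t f t.
Proof.
move=> mphi iphi mf f0; elim: n => [|n ih] in phi f mphi iphi mf f0 *.
  by apply: eq_integral => t _; congr f; rewrite [LHS]tuple0 [RHS]tuple0.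
have mmap : measurable_fun setT
    (fun t : n.+1.-tuple T => [tuple phi i (tnth t i) | i < n.+1]).
  apply/measurable_fun_tnthP => i.
  rewrite (_ : _ \o _ = phi i \o (fun t => tnth t i)); last first.
    by apply/funext => t /=; rewrite tnth_mktuple.
  by apply: measurableT_comp => //; exact: measurable_tnth.
rewrite ge0_integral_tuple_measureS//; last exact: measurableT_comp.
have mfc : measurable_fun setT (f \o @tuple_cons T n).
  by apply: measurableT_comp => //; exact: measurable_tuple_cons.
pose h x := \int[tuple_measure mu n]_t f (tuple_cons (x, t)).
transitivity (\int[mu]_x h (phi ord0 x)).
  apply: eq_integral => x _.
  rewrite -[RHS](ih (fun i => phi (lift ord0 i))
    (fun t => f (tuple_cons (phi ord0 x, t))))//.
  - apply: eq_integral => t _; congr f.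
    apply: eq_from_tnth => i; rewrite tnth_mktuple.
    case: (unliftP ord0 i) => [j|] -> //.
    by rewrite !tnthS/= tnth_mktuple.
  - by move=> i; exact: iphi.
  - by apply: measurableT_comp => //; exact: measurable_tuple_consr.
rewrite iphi; last by move=> x; exact: integral_ge0.
  by rewrite ge0_integral_tuple_measureS.
apply: (measurable_fun_fubini_tonelli_F (m2 := tuple_measure mu n) _ mfc).
by move=> z; exact: f0.
Qed.

Lemma ge0_integral_tuple_prod n (f : 'I_n -> T -> \bar R) :
  (forall i, measurable_fun setT (f i)) -> (forall i x, 0 <= f i x) ->
  \int[tuple_measure mu n]_t (\prod_(i < n) f i (tnth t i)) =
  \prod_(i < n) \int[mu]_x f i x.
Proof.
move=> mf f0; elim: n => [|n ih] in f mf f0 *.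
  under eq_integral do rewrite big_ord0.
  by rewrite big_ord0 integral_dirac//= diracT mul1e.
have mprod k (g : 'I_k -> T -> \bar R) :
    (forall i, measurable_fun setT (g i)) ->
    measurable_fun setT (fun t : k.-tuple T => \prod_(i < k) g i (tnth t i)).
  move=> mg; apply: (@emeasurable_prod _ _ _ _ _ _
    (fun i (t : k.-tuple T) => g i (tnth t i))) => i.
  by apply: measurableT_comp => //; exact: measurable_tnth.
rewrite ge0_integral_tuple_measureS//; last 2 first.
  exact: mprod.
  by move=> t; exact: prode_ge0.
rewrite big_ord_recl -(ih (fun i => f (lift ord0 i)))//.
rewrite -ge0_integralZr//; last first.
  by apply: integral_ge0 => t _; exact: prode_ge0.
apply: eq_integral => x _.
rewrite -ge0_integralZl//; last 2 first.
  exact: (mprod _ (fun i => f (lift ord0 i))).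
  by move=> t _; exact: prode_ge0.
apply: eq_integral => t _; rewrite big_ord_recl; congr (_ * _).
by apply: eq_bigr => i _; rewrite tnthS.
Qed.

End tuple_measure_integral.

(** * Translation and reflection invariance of Lebesgue measure *)

Section Rn_invariance.
Context (R : realType).
Local Open Scope ereal_scope.
Notation mu := (@lebesgue_measure R).

Lemma measurable_Rsub1 (a : R) :
  measurable_fun setT
    (fun x : measurableTypeR R => x - a : measurableTypeR R)%R.
Proof. by apply: measurable_funB => //; exact: measurable_cst. Qed.

Lemma measurable_Rsub2 (a : R) :
  measurable_fun setT
    (fun x : measurableTypeR R => a - x : measurableTypeR R)%R.
Proof. by apply: measurable_funB => //; exact: measurable_cst. Qed.

Lemma lebesgue_measure_subr (a : R) (A : set R) : measurable A ->
  pushforward mu (fun x : measurableTypeR R => x - a : measurableTypeR R)%R A =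
  mu A.
Proof.
move=> mA; apply/esym.
pose nu : {measure set _ -> \bar R} :=
  measure_function_pushforward__canonical__measure_function_Measure
    mu (measurable_Rsub1 a).
(* Lebesgue measure is determined by its values on half-open intervals, and translation keeps their
   length. *)
apply: (@lebesgue_measure_unique _ nu) => //= _ [[b c]] _ <-.
rewrite /= /pushforward.
rewrite (_ : _ @^-1` _ = `](b + a)%R, (c + a)%R]%classic); last first.
  by apply/seteqP; split => x /=; rewrite !in_itv/= ltrBrDr lerBlDr.
rewrite !lebesgue_measure_itv/= !lte_fin ltrD2r; case: ifPn => // _.
by rewrite -!EFinB; congr EFin; rewrite opprD addrACA subrr addr0.
Qed.

Lemma ge0_integral_subr (a : R) (f : measurableTypeR R -> \bar R) :
  measurable_fun setT f -> (forall x, 0 <= f x) ->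
  \int[mu]_x f (x - a)%R = \int[mu]_x f x.
Proof.
move=> mf f0.
rewrite -[LHS](ge0_integral_pushforward (measurable_Rsub1 a) mu
  measurableT mf)//.
apply: eq_measure_integral => [|? A mA _]; first exact: measurable_Rsub1.
exact: lebesgue_measure_subr.
Qed.

Lemma ge0_integral_subl (a : R) (f : measurableTypeR R -> \bar R) :
  measurable_fun setT f -> (forall x, 0 <= f x) ->
  \int[mu]_x f (a - x)%R = \int[mu]_x f x.
Proof.
move=> mf f0; rewrite -[RHS](ge0_integral_subr (- a)%R)//.
(* Here [g x = f (x + a)], so the left side integrates [g (- x)]: the map [x -> a - x] splits into a
   translation and the reflection at 0. *)
pose g : measurableTypeR R -> \bar R := fun x => f (x - - a)%R.
have mg : measurable_fun setT g.
  by apply: measurableT_comp => //; exact: measurable_Rsub1.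
have mN : measurable_fun setT (-%R : measurableTypeR R -> measurableTypeR R).
  by apply: measurable_funN.
rewrite -/(integral _ _ g) [LHS](_ : _ = \int[mu]_x (g \o -%R) x); last first.
  by apply: eq_integral => x _; rewrite /g/= opprK addrC.
rewrite -[LHS](ge0_integral_pushforward mN mu measurableT mg).
  by apply: eq_measure_integral => A mA _; exact: lebesgue_measureN.
by move=> x _; exact: f0.
Qed.

Lemma ge0_integral_Rn_sub1 n (y : Rn R n) (f : Rn R n -> \bar R) :
  measurable_fun setT f -> (forall x, 0 <= f x) ->
  \int[Rn_lebesgue R n]_x f (Rn_sub x y) = \int[Rn_lebesgue R n]_x f x.
Proof.
move=> mf f0.
apply: (@ge0_integral_tuple_map _ _ _ mu n (fun i x => x - tnth y i)%R) => //.
  by move=> i; exact: measurable_Rsub1.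
by move=> i h mh h0; exact: ge0_integral_subr.
Qed.

Lemma ge0_integral_Rn_sub2 n (x : Rn R n) (f : Rn R n -> \bar R) :
  measurable_fun setT f -> (forall x, 0 <= f x) ->
  \int[Rn_lebesgue R n]_y f (Rn_sub x y) = \int[Rn_lebesgue R n]_y f y.
Proof.
move=> mf f0.
apply: (@ge0_integral_tuple_map _ _ _ mu n (fun i y => tnth x i - y)%R) => //.
  by move=> i; exact: measurable_Rsub2.
by move=> i h mh h0; exact: ge0_integral_subl.
Qed.

Lemma measurable_Rn_sub n :
  measurable_fun setT (fun z : Rn R n * Rn R n => Rn_sub z.1 z.2).
Proof.
apply/measurable_fun_tnthP => i.
rewrite (_ : _ \o _ = fun z : Rn R n * Rn R n =>
    tnth z.1 i - tnth z.2 i : measurableTypeR R)%R; last first.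
  by apply/funext => z /=; rewrite tnth_mktuple.
apply: measurable_funB.
  by apply: (measurableT_comp (measurable_tnth i)); exact: measurable_fst.
by apply: (measurableT_comp (measurable_tnth i)); exact: measurable_snd.
Qed.

End Rn_invariance.

(** * Splitting exponents into Hölder weights *)

Section poweR_weights.
Context {R : realType}.
Local Open Scope ereal_scope.

Lemma poweR_sum (I : Type) (s : seq I) (w : I -> R) (x : \bar R) :
  (forall i, 0 <= w i)%R ->
  x `^ (\sum_(i <- s) w i)%R = \prod_(i <- s) x `^ w i.
Proof.
move=> w0; elim: s => [|i s ih]; first by rewrite !big_nil poweRe0.
rewrite !big_cons -ih.
(* The exponent law for [poweR] is applied with a nonzero sum of exponents, so a zero weight is
   treated apart. *)
have [->|wi0] := eqVneq (w i) 0%R; first by rewrite add0r poweRe0 mul1e.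
rewrite poweRD// add_neq0_poweRD_def// gt_eqF// ltr_wpDr ?sumr_ge0//.
by rewrite lt_neqAle eq_sym wi0 w0.
Qed.

(** Each [a k] gives [u] to the common product and [w k] to its pairing with [b], which keeps [v]
    for itself. This is used twice: on the functions to prepare Hölder in [y], and on their
    integrals to recognise the final bound. *)
Lemma prod_poweR_weights m (u v : R) (w : 'I_m -> R) (a : 'I_m -> \bar R)
    (b : \bar R) :
  (0 < u)%R -> (0 < v)%R -> (forall k, 0 < w k)%R ->
  (forall k, 0 <= a k) -> 0 <= b ->
  \prod_(k < m) a k `^ (u + w k) * b `^ (v + \sum_(k < m) w k) =
  (\prod_(k < m) a k) `^ u * b `^ v * \prod_(k < m) (b * a k) `^ w k.
Proof.
move=> u0 v0 w0 a0 b0.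
have wge0 k : (0 <= w k)%R by exact: ltW.
rewrite poweRD; last first.
  by rewrite add_neq0_poweRD_def// gt_eqF// ltr_wpDr// sumr_ge0.
rewrite poweR_sum// poweR_prod//.
under eq_bigr do rewrite poweRD ?add_neq0_poweRD_def ?gt_eqF ?addr_gt0//.
under [X in _ = _ * X]eq_bigr do rewrite poweRM//.
by rewrite !big_split/= muleACA; congr (_ * _); exact: muleC.
Qed.

End poweR_weights.

(** * The inequality for nonnegative functions *)

Section multiconv_ineq.
Context (R : realType) (n m : nat).
Local Open Scope ereal_scope.
Notation mu := (Rn_lebesgue R n).
Notation nu := (Rnm_lebesgue R n m).

Lemma measurable_Rn_sub_tnth (k : 'I_m) :
  measurable_fun setT (fun z : Rn R n * Rnm R n m => Rn_sub z.1 (tnth z.2 k)).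
Proof.
apply: (measurableT_comp (@measurable_Rn_sub R n)
  (g := fun z : Rn R n * Rnm R n m => (z.1, tnth z.2 k))).
apply: measurable_fun_pair; first exact: measurable_fst.
by apply: (measurableT_comp (measurable_tnth k)); exact: measurable_snd.
Qed.

Variables (G : 'I_m -> Rn R n -> \bar R) (K : Rnm R n m -> \bar R).
Hypotheses (mG : forall k, measurable_fun setT (G k))
  (G0 : forall k x, 0 <= G k x) (mK : measurable_fun setT K)
  (K0 : forall y, 0 <= K y).

Let mGs k : measurable_fun setT
  (fun z : Rn R n * Rnm R n m => G k (Rn_sub z.1 (tnth z.2 k))).
Proof. by apply: (measurableT_comp (mG k)); exact: measurable_Rn_sub_tnth. Qed.

Let mK2 : measurable_fun setT (fun z : Rn R n * Rnm R n m => K z.2).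
Proof. by apply: (measurableT_comp mK); exact: measurable_snd. Qed.

Let mKGs k : measurable_fun setT
  (fun z : Rn R n * Rnm R n m => K z.2 * G k (Rn_sub z.1 (tnth z.2 k))).
Proof. exact: emeasurable_funM. Qed.

Let mpow (r : 'I_m -> R) t : measurable_fun setT
  (fun z : Rn R n * Rnm R n m =>
     \prod_(k < m) G k (Rn_sub z.1 (tnth z.2 k)) `^ r k * K z.2 `^ t).
Proof.
apply: emeasurable_funM; last exact: (measurableT_comp (@measurable_poweR _ _)).
apply: emeasurable_prod => k.
exact: (measurableT_comp (@measurable_poweR _ _)).
Qed.

Let Phi k x := \int[nu]_y (K y * G k (Rn_sub x (tnth y k))).

Let Phi_ge0 k x : 0 <= Phi k x.
Proof. by apply: integral_ge0 => y _; exact: mule_ge0. Qed.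

Let mPhi k : measurable_fun setT (Phi k).
Proof.
apply: (measurable_fun_fubini_tonelli_F (m2 := nu) _ (mKGs k)).
by move=> z; exact: mule_ge0.
Qed.

(** After Tonelli the inner integral in [x] is that of a translate of [G k], hence independent of
    [y]. *)
Let integral_Phi k : \int[mu]_x Phi k x = \int[nu]_y K y * \int[mu]_x G k x.
Proof.
rewrite /Phi (fubini_tonelli _ (mKGs k)); last by move=> z; exact: mule_ge0.
rewrite -ge0_integralZr//; last exact: integral_ge0.
apply: eq_integral => y _ /=.
rewrite ge0_integralZl//; last exact: (measurable_fun_pair1 y (mGs k)).
by rewrite ge0_integral_Rn_sub1.
Qed.

Lemma multiconv_pointwise_le (u v : R) (w : 'I_m -> R) x :
  (0 < u)%R -> (0 < v)%R -> (forall k, 0 < w k)%R ->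
  (u + v + \sum_(k < m) w k = 1)%R ->
  \int[nu]_y (\prod_(k < m) G k (Rn_sub x (tnth y k)) `^ (u + w k) *
              K y `^ (v + \sum_(k < m) w k)) <=
  (\prod_(k < m) \int[mu]_x G k x) `^ u * (\int[nu]_y K y) `^ v *
  \prod_(k < m) Phi k x `^ w k.
Proof.
move=> u0 v0 w0 uvw1.
under eq_integral do rewrite prod_poweR_weights//.
apply: (le_trans (hoelder_prod2 nu u0 v0 w0 uvw1 _ mK _ _ _ _)).
- by apply: emeasurable_prod => k; exact: (measurable_fun_pair2 x (mGs k)).
- by move=> k; exact: (measurable_fun_pair2 x (mKGs k)).
- by move=> y; exact: prode_ge0.
- by [].
- by move=> k y; exact: mule_ge0.
(* Only the first integral differs in form from the claim: its integrand is a product of functions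
   of separate [y_k], so it factors, and each [y_k -> x - y_k] preserves the measure. *)
rewrite le_eqVlt; apply/orP; left; apply/eqP; congr (_ `^ _ * _ * _).
rewrite (ge0_integral_tuple_prod mu (f := fun k y => G k (Rn_sub x y)))//.
  by apply: eq_bigr => k _; rewrite ge0_integral_Rn_sub2.
move=> k; apply: (measurableT_comp (mG k)).
exact: (measurable_fun_pair2 x (@measurable_Rn_sub R n)).
Qed.

Lemma multiconv_ge0_le (u v q : R) (w : 'I_m -> R) :
  (0 < u)%R -> (0 < v)%R -> (forall k, 0 < w k)%R -> (0 < q)%R ->
  (u + v + \sum_(k < m) w k = 1)%R -> (q * \sum_(k < m) w k = 1)%R ->
  \int[mu]_x (\int[nu]_y
     (\prod_(k < m) G k (Rn_sub x (tnth y k)) `^ (u + w k) *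
      K y `^ (v + \sum_(k < m) w k))) `^ q <=
  (\prod_(k < m) (\int[mu]_x G k x) `^ (u + w k) *
    (\int[nu]_y K y) `^ (v + \sum_(k < m) w k)) `^ q.
Proof.
move=> u0 v0 w0 q0 uvw1 qw1.
have iG0 k : 0 <= \int[mu]_x G k x by exact: integral_ge0.
have iK0 : 0 <= \int[nu]_y K y by exact: integral_ge0.
rewrite prod_poweR_weights//.
set c := (_ `^ u * _ `^ v).
have c0 : 0 <= c by rewrite mule_ge0// poweR_ge0.
have mPhiw k r : measurable_fun setT (fun x => Phi k x `^ r).
  exact: (measurableT_comp (@measurable_poweR _ _)).
have prodPhi0 x : 0 <= \prod_(k < m) Phi k x `^ w k.
  by apply: prode_ge0 => *; exact: poweR_ge0.
have int0 x : 0 <= \int[nu]_y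
     (\prod_(k < m) G k (Rn_sub x (tnth y k)) `^ (u + w k) *
      K y `^ (v + \sum_(k < m) w k)).
  apply: integral_ge0 => y _; rewrite mule_ge0 ?poweR_ge0//.
  by apply: prode_ge0 => *; exact: poweR_ge0.
apply: (@le_trans _ _ (\int[mu]_x (c * \prod_(k < m) Phi k x `^ w k) `^ q)).
  apply: ge0_le_integral => //.
  - by move=> x _; exact: poweR_ge0.
  - apply: (measurableT_comp (@measurable_poweR _ q)
      (g := fun x => \int[nu]_y _)).
    apply: (measurable_fun_fubini_tonelli_F (m2 := nu) _
      (mpow (fun k => u + w k)%R (v + \sum_(k < m) w k)%R)).
    move=> z; rewrite mule_ge0 ?poweR_ge0//.
    by apply: prode_ge0 => *; exact: poweR_ge0.
  - apply: (measurableT_comp (@measurable_poweR _ q) (g := fun x => c * _)).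
    by apply: emeasurable_funM => //; exact: emeasurable_prod.
  - move=> x _; apply: gt0_ler_poweR; first exact: ltW.
    + by rewrite in_itv/= int0 leey.
    + by rewrite in_itv/= leey mule_ge0.
    + exact: multiconv_pointwise_le.
under eq_integral => x _.
  rewrite poweRM// poweR_prod; last by move=> *; exact: poweR_ge0.
  under eq_bigr do rewrite -poweRrM.
  over.
rewrite ge0_integralZl//; last 3 first.
- by apply: emeasurable_prod => k.
- by move=> x _; apply: prode_ge0 => *; exact: poweR_ge0.
- exact: poweR_ge0.
rewrite poweRM//; last by apply: prode_ge0 => *; exact: poweR_ge0.
(* The common factor [c ^ q] cancels, leaving Hölder in [x] with weights [w k * q]. *)
rewrite lee_wpmul2l ?poweR_ge0// poweR_prod; last by move=> *; exact: poweR_ge0.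
under [leRHS]eq_bigr do rewrite -poweRrM -integral_Phi.
apply: hoelder_prod => //.
- by move=> k; exact: mulr_gt0.
- by rewrite -mulr_suml mulrC.
Qed.

End multiconv_ineq.

(** * Measurability and modulus of complex-valued functions *)

Section complex_measurable.
Context d (T : measurableType d) (R : realType).
Implicit Types f g : T -> R[i].

Lemma cmeasurable_funM f g : cmeasurable_fun f -> cmeasurable_fun g ->
  cmeasurable_fun (fun x => f x * g x).
Proof.
move=> [fr fi] [gr gi].
have ReM (z w : R[i]) : complex.Re (z * w) =
  complex.Re z * complex.Re w - complex.Im z * complex.Im w.
  by case: z w => ? ? [].
have ImM (z w : R[i]) : complex.Im (z * w) =
  complex.Re z * complex.Im w + complex.Im z * complex.Re w.
  by case: z w => ? ? [].
split.
- under eq_fun do rewrite ReM.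
  by apply: measurable_funB; exact: measurable_funM.
- under eq_fun do rewrite ImM.
  by apply: measurable_funD; exact: measurable_funM.
Qed.

Lemma cmeasurable_fun_prod (I : Type) (s : seq I) (f : I -> T -> R[i]) :
  (forall i, cmeasurable_fun (f i)) ->
  cmeasurable_fun (fun x => \prod_(i <- s) f i x).
Proof.
move=> mf; elim: s => [|i s ih].
  by under eq_fun do rewrite big_nil; split; exact: measurable_cst.
by under eq_fun do rewrite big_cons; exact: cmeasurable_funM.
Qed.

Lemma cmeasurable_fun_comp d' (U : measurableType d') (f : T -> R[i])
    (h : U -> T) : measurable_fun setT h -> cmeasurable_fun f ->
  cmeasurable_fun (f \o h).
Proof.
move=> mh [fr fi].
by split; [exact: (measurableT_comp fr)|exact: (measurableT_comp fi)].
Qed.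

Lemma normcE (z : R[i]) :
  Normc.normc z = Num.sqrt (complex.Re z ^+ 2 + complex.Im z ^+ 2).
Proof. by case: z. Qed.

Lemma normc_ge0 (z : R[i]) : 0 <= Normc.normc z.
Proof. by rewrite normcE sqrtr_ge0. Qed.

Lemma normr_Re_le_normc (z : R[i]) : `|complex.Re z| <= Normc.normc z.
Proof. by rewrite normcE -sqrtr_sqr ler_wsqrtr// lerDl sqr_ge0. Qed.

Lemma normr_Im_le_normc (z : R[i]) : `|complex.Im z| <= Normc.normc z.
Proof. by rewrite normcE -sqrtr_sqr ler_wsqrtr// lerDr sqr_ge0. Qed.

Lemma normc_prod (I : Type) (s : seq I) (a : I -> R[i]) :
  Normc.normc (\prod_(i <- s) a i) = \prod_(i <- s) Normc.normc (a i).
Proof.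
elim: s => [|i s ih]; last by rewrite !big_cons Normc.normcM ih.
by rewrite !big_nil normcE/= expr1n expr0n addr0 sqrtr1.
Qed.

Lemma measurable_normc f : cmeasurable_fun f ->
  measurable_fun setT (@Normc.normc R \o f).
Proof.
move=> [fr fi].
rewrite (_ : _ \o _ = fun x =>
    Num.sqrt (complex.Re (f x) ^+ 2 + complex.Im (f x) ^+ 2)); last first.
  by apply/funext => x /=; rewrite normcE.
apply: (measurableT_comp (f := @Num.sqrt R)).
  by apply: continuous_measurable_fun; exact: sqrt_continuous.
by apply: measurable_funD; exact: measurable_funX.
Qed.

End complex_measurable.

(** * Complex integrals and their modulus *)

Section complex_integral.
Context d (T : measurableType d) (R : realType).
Variable mu : {measure set T -> \bar R}.
Implicit Type f : T -> R[i].

Lemma cintegrable_normc f : cmeasurable_fun f ->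
  mu.-integrable setT (fun x => (Normc.normc (f x))%:E) -> cintegrable mu f.
Proof.
move=> [fr fi] fint; split.
- apply: le_integrable fint => //; first exact/measurable_EFinP.
  move=> x _; rewrite lee_fin [leRHS]ger0_norm ?normc_ge0//.
  exact: normr_Re_le_normc.
- apply: le_integrable fint => //; first exact/measurable_EFinP.
  move=> x _; rewrite lee_fin [leRHS]ger0_norm ?normc_ge0//.
  exact: normr_Im_le_normc.
Qed.

Lemma cauchy_schwarz2 (a b u v : R) :
  a * u + b * v <= Num.sqrt (a ^+ 2 + b ^+ 2) * Num.sqrt (u ^+ 2 + v ^+ 2).
Proof.
rewrite (le_trans (ler_norm _))// -sqrtr_sqr -sqrtrM ?addr_ge0 ?sqr_ge0//.
rewrite ler_wsqrtr// -subr_ge0.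
(* Lagrange's identity in two dimensions. *)
rewrite (_ : _ - _ = (a * v - b * u) ^+ 2) ?sqr_ge0//.
by ring.
Qed.

Lemma normc_cintegral_le f : cmeasurable_fun f ->
  mu.-integrable setT (fun x => (Normc.normc (f x))%:E) ->
  Normc.normc (cintegral mu f) <= \int[mu]_x Normc.normc (f x).
Proof.
move=> mf fint; have [ir ii] := cintegrable_normc mf fint.
rewrite /cintegral normcE/=.
set a := \int[mu]_x _; set b := \int[mu]_x _.
set N := Num.sqrt _.
have N0 : 0 <= N := sqrtr_ge0 _.
have [->|Nneq0] := eqVneq N 0.
  by apply: Rintegral_ge0 => x _; exact: normc_ge0.
have {Nneq0}Ngt0 : 0 < N by rewrite lt_neqAle eq_sym Nneq0.
(* N ^ 2 = a * \int Re f + b * \int Im f, and Cauchy-Schwarz bounds the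
   integrand of the right-hand side by N * |f| *)
have ira : mu.-integrable setT (EFin \o (fun x => a * complex.Re (f x))).
  exact: (@integrableZl _ _ _ mu _ measurableT a _ ir).
have iib : mu.-integrable setT (EFin \o (fun x => b * complex.Im (f x))).
  exact: (@integrableZl _ _ _ mu _ measurableT b _ ii).
rewrite -(ler_pM2l Ngt0) -expr2 sqr_sqrtr ?addr_ge0 ?sqr_ge0// !expr2.
(* In each square one factor stays a constant and the other is unfolded into its integral, so that
   linearity applies. *)
rewrite {2}/a {2}/b.
rewrite -!RintegralZl// -RintegralD//.
apply: le_Rintegral => //.
- exact: (@integrableD _ _ _ mu _ measurableT _ _ ira iib).
- exact: (@integrableZl _ _ _ mu _ measurableT N _ fint).
- by move=> x _; rewrite normcE; exact: cauchy_schwarz2.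
Qed.

Lemma cLnormE (r : R) f :
  (cLnorm mu r f = (\int[mu]_x (Normc.normc (f x) `^ r)%:E) `^ r^-1)%E.
Proof.
rewrite /cLnorm unlock; congr (_ `^ _)%E; apply: eq_integral => x _ /=.
by rewrite ger0_norm ?normc_ge0.
Qed.

End complex_integral.

(** * Measurability of integrals in a parameter *)

Section complex_parameter_integral.
Context d1 d2 (T1 : measurableType d1) (T2 : measurableType d2) (R : realType).
Variable mu : {sigma_finite_measure set T2 -> \bar R}.

(** Tonelli makes the integrals of the positive and negative parts measurable in [x]; their
    difference and [fine] stay measurable even at infinite values, so no integrability is
    assumed. *)
Lemma measurable_Rintegral_pair (f : T1 * T2 -> R) : measurable_fun setT f ->
  measurable_fun setT (fun x => \int[mu]_y f (x, y)).
Proof.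
move=> mf; have mEf : measurable_fun setT (EFin \o f) by exact/measurable_EFinP.
apply: (measurableT_comp (@fine_measurable R _ measurableT)).
rewrite (_ : (fun x => _) =
    (fun x => \int[mu]_y (EFin \o f)^\+ (x, y))%E \-
    (fun x => \int[mu]_y (EFin \o f)^\- (x, y))%E)%E; last first.
  apply/funext => x; rewrite integralE; congr (_ - _)%E.
  - by apply: eq_integral => y _; rewrite !funeposE.
  - by apply: eq_integral => y _; rewrite !funenegE.
apply: emeasurable_funB.
- apply: (measurable_fun_fubini_tonelli_F (m2 := mu) ((EFin \o f) ^\+)%E) => //.
  exact: measurable_funepos.
- apply: (measurable_fun_fubini_tonelli_F (m2 := mu) ((EFin \o f) ^\-)%E) => //.
  exact: measurable_funeneg.
Qed.

Lemma cmeasurable_cintegral_pair (f : T1 * T2 -> R[i]) : cmeasurable_fun f ->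
  cmeasurable_fun (fun x => cintegral mu (fun y => f (x, y))).
Proof.
move=> [fr fi]; split.
- exact: (measurable_Rintegral_pair (f := fun z => complex.Re (f z))).
- exact: (measurable_Rintegral_pair (f := fun z => complex.Im (f z))).
Qed.

End complex_parameter_integral.

(** * The inequality for complex-valued functions *)

Lemma cmeasurable_multiconv_integrand (R : realType) (n m : nat)
    (g : 'I_m -> Rn R n -> R[i]) (H : Rnm R n m -> R[i]) :
  (forall k, cmeasurable_fun (g k)) -> cmeasurable_fun H ->
  cmeasurable_fun
    (fun z : Rn R n * Rnm R n m => multiconv_integrand g H z.1 z.2).
Proof.
move=> mg mH; apply: cmeasurable_funM.
  apply: cmeasurable_fun_prod => k.
  by apply: (cmeasurable_fun_comp _ (mg k)); exact: measurable_Rn_sub_tnth.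
by apply: (cmeasurable_fun_comp _ mH); exact: measurable_snd.
Qed.

Theorem theorem2 (R : realType) (n m : nat) (p q p' q' : R) (s : 'I_m -> R) :
  (1 <= n)%N -> (1 <= m)%N ->
  1 < p -> p < q ->
  p^-1 + p'^-1 = 1 -> q^-1 + q'^-1 = 1 ->
  m%:R < p' / q' ->
  (forall k : 'I_m, 1 < s k /\ s k < p' / q') ->
  q^-1 + m%:R / p' = \sum_(k < m) (s k)^-1 ->
  exists C : R, C <= 1 /\
    forall (g : 'I_m -> Rn R n -> R[i]) (H : Rnm R n m -> R[i]),
      (forall k : 'I_m, cLfun (Rn_lebesgue R n) (s k) (g k)) ->
      cLfun (Rnm_lebesgue R n m) p H ->
      [/\ {ae Rn_lebesgue R n, forall x,
             cintegrable (Rnm_lebesgue R n m) (multiconv_integrand g H x)},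
          cLfun (Rn_lebesgue R n) q (multiconv g H) &
          (cLnorm (Rn_lebesgue R n) q (multiconv g H)
           <= C%:E * (\prod_(k < m) cLnorm (Rn_lebesgue R n) (s k) (g k))
              * cLnorm (Rnm_lebesgue R n m) p H)%E].
Proof.
move=> _ _ p_gt1 pq pp' qq' _ s_bound sum_s; exists 1; split=> // g H Lg LH.
set mu := Rn_lebesgue R n; set nu := Rnm_lebesgue R n m.
have p_gt0 : 0 < p by exact: lt_trans p_gt1.
have q_gt1 : 1 < q by exact: lt_trans pq.
have q_gt0 : 0 < q by exact: lt_trans pq.
pose u := p'^-1; pose v := q'^-1 - p'^-1; pose w k := (s k)^-1 - p'^-1.
have uE : u = 1 - p^-1 by rewrite -pp' addrC addKr.
have q'E : q'^-1 = 1 - q^-1 by rewrite -qq' addrC addKr.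
have u_gt0 : 0 < u by rewrite uE subr_gt0 invf_lt1.
have p'_gt0 : 0 < p' by rewrite -invr_gt0.
(* In fact [v = 1/p - 1/q], positive because [p < q]. *)
have v_gt0 : 0 < v.
  by rewrite /v q'E -/u uE subr_gt0 ltrD2l ltrN2 ltf_pV2.
have s_gt0 k : 0 < s k by have [/(lt_trans ltr01)] := s_bound k.
(* From [s k < p' / q'] one gets [s k < p'], because [1/q' = 1 - 1/q] is at most 1. *)
have w_gt0 k : 0 < w k.
  rewrite subr_gt0 ltf_pV2 ?posrE//; have [_ /lt_le_trans] := s_bound k; apply.
  by rewrite ler_piMr ?(ltW p'_gt0)// q'E gerBl invr_ge0 ltW.
(* This is the balance condition on the exponents with [m / p'] moved across; it yields the total
   weight 1 in both uses of Hölder. *)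
have sum_w : \sum_(k < m) w k = q^-1.
  by rewrite sumrB -sum_s sumr_const card_ord -[X in _ - X]mulr_natl addrK.
have uwE k : u + w k = (s k)^-1 by rewrite addrC subrK.
have vwE : v + \sum_(k < m) w k = p^-1.
  by rewrite sum_w /v q'E -/u uE; ring.
pose G k x := (Normc.normc (g k x) `^ s k)%:E.
pose K y := (Normc.normc (H y) `^ p)%:E.
have mpowc d (T : measurableType d) (f : T -> R[i]) r : cmeasurable_fun f ->
    measurable_fun setT (fun x => (Normc.normc (f x) `^ r)%:E).
  move=> mf; apply/measurable_EFinP.
  by apply: (measurableT_comp (@measurable_powR R r)); exact: measurable_normc.
have mG k : measurable_fun setT (G k) by apply: mpowc; have [] := Lg k.
have mK : measurable_fun setT K by apply: mpowc; have [] := LH.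
have mI := cmeasurable_multiconv_integrand (fun k => (Lg k).1) LH.1.
(* The integral of the modulus is defined at every [x], with value [+oo] allowed, so it can be
   estimated before any integrability is known. *)
pose N x := (\int[nu]_y (Normc.normc (multiconv_integrand g H x y))%:E)%E.
have IE x y : (Normc.normc (multiconv_integrand g H x y))%:E =
    (\prod_(k < m) G k (Rn_sub x (tnth y k)) `^ (u + w k) *
     K y `^ (v + \sum_(k < m) w k))%E.
  have powK (z r : R) : 0 <= z -> 0 < r -> (z `^ r) `^ r^-1 = z.
    by move=> z0 r0; rewrite -powRrM mulfV ?gt_eqF// powRr1.
  rewrite /multiconv_integrand Normc.normcM normc_prod EFinM -prodEFin.
  rewrite vwE /K poweR_EFin powK ?normc_ge0//; congr (_ * _)%E.
  by apply: eq_bigr => k _; rewrite uwE /G poweR_EFin powK ?normc_ge0.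
pose M := (\prod_(k < m) cLnorm mu (s k) (g k) * cLnorm nu p H)%E.
have key : (\int[mu]_x N x `^ q <= M `^ q)%E.
  rewrite [leRHS](_ : _ = (\prod_(k < m) (\int[mu]_x G k x) `^ (u + w k) *
      (\int[nu]_y K y) `^ (v + \sum_(k < m) w k))%E `^ q)%E; last first.
    rewrite vwE /M cLnormE; congr ((_ * _) `^ _)%E.
    by apply: eq_bigr => k _; rewrite uwE cLnormE.
  rewrite /N; under eq_integral do under eq_integral do rewrite IE.
  apply: multiconv_ge0_le => //.
  - by move=> k x; rewrite lee_fin powR_ge0.
  - by move=> y; rewrite lee_fin powR_ge0.
  - by rewrite -addrA vwE -pp' addrC.
  - by rewrite sum_w mulfV// gt_eqF.
have M0 : (0 <= M)%E.
  by rewrite mule_ge0 ?Lnorm_ge0//; apply: prode_ge0 => *; exact: Lnorm_ge0.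
have Moo : (M < +oo)%E.
  rewrite -ge0_fin_numE// fin_numM//; last first.
    by rewrite ge0_fin_numE ?Lnorm_ge0// LH.2.
  by apply: prode_fin_num => k _; rewrite ge0_fin_numE ?Lnorm_ge0// (Lg k).2.
have mnI : measurable_fun setT (fun z : Rn R n * Rnm R n m =>
    (Normc.normc (multiconv_integrand g H z.1 z.2))%:E).
  by apply/measurable_EFinP; exact: measurable_normc.
have N0 x : (0 <= N x)%E.
  by apply: integral_ge0 => y _; rewrite lee_fin normc_ge0.
have mN : measurable_fun setT N.
  apply: (measurable_fun_fubini_tonelli_F (m2 := nu) _ mnI) => z.
  by rewrite lee_fin normc_ge0.
have mNq : measurable_fun setT (fun x => N x `^ q)%E.
  exact: (measurableT_comp (@measurable_poweR R q)).
have mIx x : cmeasurable_fun (multiconv_integrand g H x).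
  exact: (cmeasurable_fun_comp (pair1_measurable x) mI).
(* By [key] the function [N ^ q] has finite integral, so [N] is finite almost everywhere, which is
   integrability of the integrand there. *)
have int_ae : {ae mu, forall x, nu.-integrable setT
    (fun y => (Normc.normc (multiconv_integrand g H x y))%:E)}.
  have : mu.-integrable setT (fun x => N x `^ q)%E.
    apply/integrableP; split=> //.
    under eq_integral do rewrite gee0_abs ?poweR_ge0//.
    by rewrite (le_lt_trans key)// poweR_lty.
  move/(integrable_ae measurableT); apply: filterS => x /(_ Logic.I).
  rewrite ge0_fin_numE ?poweR_ge0// => /lty_poweRy Nx.
  apply/integrableP; split.
    exact: (measurable_fun_pair2 x mnI).
  under eq_integral do rewrite gee0_abs ?lee_fin ?normc_ge0//.
  by apply: Nx; rewrite gt_eqF.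
have mF : cmeasurable_fun (multiconv g H).
  exact: (cmeasurable_cintegral_pair nu mI).
have F_le : (cLnorm mu q (multiconv g H) <= M)%E.
  have -> : M = ((M `^ q) `^ q^-1)%E.
    by rewrite -poweRrM mulfV ?gt_eqF// poweRe1.
  rewrite cLnormE; apply: gt0_ler_poweR.
  - by rewrite invr_ge0 ltW.
  - rewrite in_itv/= leey andbT; apply: integral_ge0 => x _.
    by rewrite lee_fin powR_ge0.
  - by rewrite in_itv/= leey poweR_ge0.
  (* The bound of [|F|] by [N] is drawn from integrability of the integrand, known for almost every
     [x], so the two integrals are compared almost everywhere. *)
  apply: le_trans key; apply: ae_ge0_le_integral => //.
  - by move=> x _; rewrite lee_fin powR_ge0.
  - exact: mpowc.
  - by move=> x _; exact: poweR_ge0.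
  apply: filterS int_ae => x intx _.
  have Nx : N x = (\int[nu]_y Normc.normc (multiconv_integrand g H x y))%:E.
    rewrite /Rintegral fineK//; apply: integrable_fin_num => //.
  rewrite Nx poweR_EFin lee_fin ge0_ler_powR ?nnegrE ?normc_ge0 ?(ltW q_gt0)//.
    by apply: Rintegral_ge0 => y _; exact: normc_ge0.
  exact: normc_cintegral_le.
split.
- by apply: filterS int_ae => x; exact: cintegrable_normc.
- by split=> //; exact: le_lt_trans Moo.
- by rewrite mul1e.
Qed.
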